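(* Let $A$ be an analytic function in $\mathbb{D}$. If there exists $0\leq r_0<1$ such that $$\sup_{r_0<r<1} \, M_\infty(r,A)\,(1-r)^2 \exp\left(\int_{r_0}^r M_\infty(t,A)\,(1-t)\,dt\right)<\infty,$$ then every analytic solution $f$ in $\mathbb{D}$ of the differential equation $f''+Af=0$ belongs to the Bloch space $\mathcal{B}$.
   Context: $\mathbb{D}=\{z\in\mathbb{C}:|z|<1\}$ is the open unit disc. For $A$ analytic in $\mathbb{D}$ and $0\le r<1$, $M_\infty(r,A)=\max_{|z|=r}|A(z)|$. The Bloch space $\mathcal{B}$ consists of all functions $f$ analytic in $\mathbb{D}$ with $\sup_{z\in\mathbb{D}}|f'(z)|(1-|z|^2)<\infty$. *)

(* Defs.v *)
From Stdlib Require Import Reals Lra.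
From Coquelicot Require Import Coquelicot.
Open Scope R_scope.

(* [ex_derive] on functions C -> C is complex differentiability, so this is
   holomorphy in the open unit disc.  Values of f outside the disc are
   irrelevant since the disc is open. *)
Definition analytic_in_disc (f : C -> C) : Prop :=
  forall z : C, Cmod z < 1 -> ex_derive f z.

Definition is_max_modulus (r : R) (A : C -> C) (m : R) : Prop :=
  (exists z : C, Cmod z = r /\ Cmod (A z) = m) /\
  (forall z : C, Cmod z = r -> Cmod (A z) <= m).

(* "The" m with [is_max_modulus r A m]; [M_infty_correct] below shows that it
   exists for A analytic in the disc and 0 <= r < 1. *)
Definition M_infty (r : R) (A : C -> C) : R := iota (is_max_modulus r A).

(* [C_derive] is a total operator, so the existence of f'' is part of what it
   means for f'' + A f = 0 to hold (for analytic f it is automatic). *)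
Definition is_solution_in_disc (A f : C -> C) : Prop :=
  forall z : C, Cmod z < 1 ->
    ex_derive (C_derive f) z /\
    (C_derive (C_derive f) z + A z * f z = 0)%C.

Definition in_Bloch (f : C -> C) : Prop :=
  analytic_in_disc f /\
  exists K : R, forall z : C, Cmod z < 1 ->
    Cmod (C_derive f z) * (1 - Cmod z ^ 2) <= K.

Lemma is_max_modulus_unique (r : R) (A : C -> C) (m1 m2 : R) :
  is_max_modulus r A m1 -> is_max_modulus r A m2 -> m1 = m2.
Proof.
intros [[z1 [h1 e1]] u1] [[z2 [h2 e2]] u2].
apply Rle_antisym.
- rewrite <- e1. now apply u2.
- rewrite <- e2. now apply u1.
Qed.

Lemma half_circle_mod (r s x : R) :
  0 <= r -> s * s = 1 -> -r <= x <= r ->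
  Cmod (x, s * sqrt (r ^ 2 - x ^ 2)) = r.
Proof.
intros hr hs hx. unfold Cmod, fst, snd.
rewrite Rpow_mult_distr, pow2_sqrt by nra.
replace (s ^ 2) with (s * s) by ring. rewrite hs.
replace (x ^ 2 + 1 * (r ^ 2 - x ^ 2)) with (r ^ 2) by ring.
now apply sqrt_pow2.
Qed.

Lemma half_circle_max (A : C -> C) (r s : R) :
  analytic_in_disc A -> 0 <= r < 1 -> s * s = 1 ->
  exists x0 : R, -r <= x0 <= r /\
    forall x : R, -r <= x <= r ->
      Cmod (A (x, s * sqrt (r ^ 2 - x ^ 2))) <=
      Cmod (A (x0, s * sqrt (r ^ 2 - x0 ^ 2))).
Proof.
intros hA hr hs.
destruct (continuity_ab_maj
  (fun x : R => Cmod (A (x, s * sqrt (r ^ 2 - x ^ 2)))) (-r) r) as [x0 [h1 h2]].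
- lra.
- intros c hc.
  apply continuity_pt_filterlim.
  apply (filterlim_comp _ _ _ (fun x : R => A (x, s * sqrt (r ^ 2 - x ^ 2)))
           Cmod (locally c) (locally (A (c, s * sqrt (r ^ 2 - c ^ 2))))).
  + apply (filterlim_comp _ _ _ (fun x : R => (x, s * sqrt (r ^ 2 - x ^ 2)))
             A (locally c) (locally (c, s * sqrt (r ^ 2 - c ^ 2)))).
    * apply filterlim_locally. intros eps.
      assert (hc2 : continuous (fun x : R => s * sqrt (r ^ 2 - x ^ 2)) c).
      { apply (continuous_mult (fun _ => s)). { apply continuous_const. }
        apply continuous_comp; [|apply continuous_sqrt].
        apply continuity_pt_filterlim. reg. }
      generalize (proj1 (filterlim_locally _ _) hc2 eps). intros H1.
      generalize (locally_ball c eps). intros H2.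
      generalize (filter_and _ _ H1 H2). apply filter_imp.
      intros x [g1 g2]. split; [exact g2|exact g1].
    * assert (hd : ex_derive A (c, s * sqrt (r ^ 2 - c ^ 2))).
      { apply hA. rewrite half_circle_mod; [lra|lra|exact hs|exact hc]. }
      apply ex_derive_continuous in hd.
      intros P hP. specialize (hd P hP).
      unfold filtermap in hd |- *. apply locally_C in hd. exact hd.
  + exact (filterlim_norm (K := C_AbsRing) (V := C_NormedModule) _).
- exists x0. split; assumption.
Qed.

Lemma M_infty_correct (r : R) (A : C -> C) :
  analytic_in_disc A -> 0 <= r < 1 -> is_max_modulus r A (M_infty r A).
Proof.
intros hA hr.
assert (hex : exists m, is_max_modulus r A m).
{ destruct (half_circle_max A r 1 hA hr ltac:(ring)) as [x1 [b1 m1]].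
  destruct (half_circle_max A r (-1) hA hr ltac:(ring)) as [x2 [b2 m2]].
  assert (hm := fun s x => half_circle_mod r s x (proj1 hr)).
  set (M1 := Cmod (A (x1, 1 * sqrt (r ^ 2 - x1 ^ 2)))) in *.
  set (M2 := Cmod (A (x2, -1 * sqrt (r ^ 2 - x2 ^ 2)))) in *.
  exists (Rmax M1 M2). split.
  - unfold Rmax. destruct (Rle_dec M1 M2).
    + eexists; split; [|reflexivity]. apply hm; [ring|assumption].
    + eexists; split; [|reflexivity]. apply hm; [ring|assumption].
  - intros [x y] hz.
    assert (h2 : x ^ 2 + y ^ 2 = r ^ 2).
    { rewrite <- hz. unfold Cmod, fst, snd.
      rewrite pow2_sqrt; [reflexivity|nra]. }
    assert (hx : -r <= x <= r) by (split; nra).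
    destruct (Rle_dec 0 y) as [hy|hy].
    + apply Rle_trans with M1; [|apply Rmax_l].
      replace y with (1 * sqrt (r ^ 2 - x ^ 2)). { now apply m1. }
      replace (r ^ 2 - x ^ 2) with (y ^ 2) by lra.
      rewrite sqrt_pow2; lra.
    + apply Rle_trans with M2; [|apply Rmax_r].
      replace y with (-1 * sqrt (r ^ 2 - x ^ 2)). { now apply m2. }
      replace (r ^ 2 - x ^ 2) with ((- y) ^ 2) by lra.
      rewrite sqrt_pow2; lra. }
destruct hex as [m hm].
assert (heq : M_infty r A = m).
{ apply (iota_unique (V := R_CompleteNormedModule) (is_max_modulus r A)).
  - intros m' hm'. exact (is_max_modulus_unique r A m' m hm' hm).
  - exact hm. }
rewrite heq. exact hm.
Qed.

(* Main.v *)
Require Import Defs.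
From Stdlib Require Import Reals Lra.
From Coquelicot Require Import Coquelicot.
Open Scope R_scope.

(** Both the growth of f and that of f' are controlled ray by ray.  Fix a
    direction e with |e| = 1 and write M(t) for the maximum modulus of A.

    Taylor's formula of order two along the ray, with the equation substituted
    for f'', gives for r0 <= r < 1
      |f(re)| <= C0 + int_{r0}^r (r-t) |A(te)| |f(te)| dt
              <= C0 + int_{r0}^r M(t) (1-t) |f(te)| dt,
    where C0 bounds |f| + (1-r0)|f'| on the circle of radius r0 and so does not
    depend on e ([ray_taylor_le]).  Gronwall's inequality ([gronwall]) turns
    this into |f(re)| <= C0 exp(int_{r0}^r M(t)(1-t) dt) ([solution_growth]).
    The exponential is the one in the hypothesis, so
      |f''(te)| <= M(t) |f(te)| <= C0 K / (1-t)^2,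
    and integrating this once more along the ray ([ray_increment_le]) bounds
    |f'(re)| by B + C0 K / (1-r), where B bounds |f'| on the closed disc of
    radius r0.  Multiplying by 1-r gives the Bloch condition.

    The integral of M(t)(1-t) has to be a genuine Riemann integral with a
    derivative in its upper bound; this is why the continuity of the maximum
    modulus ([continuous_M_infty]) is established, from uniform continuity of
    |A| in polar coordinates.  Multiplying by a unimodular constant and taking
    real parts ([norming_scalar]) reduces every estimate along a ray to the
    comparison of real functions [increment_le]. *)

(** * Comparison of increments on the real line *)

(** The derivatives are compared in the open interval only: the hypothesis of
    the theorem says nothing at the endpoint r0. *)
Lemma increment_le (f g df dg : R -> R) (a b : R) :
  a <= b ->
  (forall t, a <= t <= b -> is_derive f t (df t)) ->
  (forall t, a <= t <= b -> is_derive g t (dg t)) ->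
  (forall t, a < t < b -> df t <= dg t) ->
  f b - f a <= g b - g a.
Proof.
intros hab hf hg hle.
destruct (Rle_lt_or_eq_dec a b hab) as [hlt|<-]; [|lra].
destruct (MVT_cor2 (fun t => f t - g t) (fun t => df t - dg t) a b hlt)
  as [c [hc hc']].
- intros t ht. apply is_derive_Reals.
  apply (is_derive_minus (K := R_AbsRing) (V := R_NormedModule));
    [now apply hf|now apply hg].
- specialize (hle c hc'). simpl in hc. nra.
Qed.

Lemma is_derive_RInt_continuous (a : R -> R) (alpha beta x t : R) :
  (forall s, alpha < s < beta -> continuous a s) ->
  alpha < x < beta -> alpha < t < beta ->
  is_derive (fun y => RInt a x y) t (a t).
Proof.
intros ha hx ht.
apply (is_derive_RInt (V := R_NormedModule) a _ x); [|now apply ha].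
assert (ho : locally t (fun y => alpha < y < beta)).
{ apply (locally_interval _ t alpha beta); simpl; tauto. }
revert ho. apply filter_imp. intros y hy.
apply (RInt_correct (V := R_CompleteNormedModule)).
apply (ex_RInt_continuous (V := R_CompleteNormedModule)).
intros s hs. apply ha.
revert hs. unfold Rmin, Rmax. destruct (Rle_dec x y); lra.
Qed.

(** With H the right-hand side of the integral inequality, H' = a u <= a H, so
    H exp(- int a) is nonincreasing.  Continuity is asked on an open interval
    around the initial point x so that the integrals have two-sided
    derivatives at x as well. *)
Lemma gronwall (a u : R -> R) (alpha beta x C0 : R) :
  alpha < x < beta ->
  (forall t, alpha < t < beta -> continuous a t) ->
  (forall t, alpha < t < beta -> continuous u t) ->
  (forall t, x <= t < beta -> 0 <= a t) ->
  (forall t, x <= t < beta -> u t <= C0 + RInt (fun s => a s * u s) x t) ->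
  forall t, x <= t < beta -> u t <= C0 * exp (RInt a x t).
Proof.
intros hx ha hu hpos hint t ht.
set (H := fun y => C0 + RInt (fun s => a s * u s) x y).
set (I := fun y => RInt a x y).
assert (hI : forall s, x <= s <= t -> is_derive I s (a s)).
{ intros s hs. apply (is_derive_RInt_continuous a alpha beta); try assumption; lra. }
assert (hH : forall s, x <= s <= t -> is_derive H s (a s * u s)).
{ intros s hs. unfold H.
  replace (a s * u s) with (plus 0 (a s * u s)) by (unfold plus; simpl; ring).
  apply (is_derive_plus (K := R_AbsRing) (V := R_NormedModule)).
  - apply (is_derive_const (K := R_AbsRing) (V := R_NormedModule) C0 s).
  - apply (is_derive_RInt_continuous (fun y => a y * u y) alpha beta); [|lra|lra].
    intros y hy. apply (continuous_mult a u); [now apply ha|now apply hu]. }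
assert (hmono : H t * exp (- I t) - H x * exp (- I x) <= 0 - 0).
{ apply (increment_le (fun s => H s * exp (- I s)) (fun _ => 0)
     (fun s => a s * u s * exp (- I s) + H s * (- a s * exp (- I s)))
     (fun _ => 0)).
  - lra.
  - intros s hs. apply (is_derive_mult H (fun s => exp (- I s))).
    + now apply hH.
    + apply (is_derive_comp exp (fun s => - I s) s).
      * apply is_derive_Reals, derivable_pt_lim_exp.
      * apply (is_derive_opp (K := R_AbsRing) (V := R_NormedModule)). now apply hI.
    + intros n m. apply Rmult_comm.
  - intros s hs. apply (is_derive_const (K := R_AbsRing) (V := R_NormedModule) 0 s).
  - intros s hs.
    assert (h1 := hpos s ltac:(lra)). assert (h2 := hint s ltac:(lra)).
    fold (H s) in h2. assert (h3 := exp_pos (- I s)).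
    replace (a s * u s * exp (- I s) + H s * (- a s * exp (- I s)))
      with (- (a s * (H s - u s) * exp (- I s))) by ring.
    enough (0 <= a s * (H s - u s) * exp (- I s)) by lra.
    apply Rmult_le_pos; [apply Rmult_le_pos; lra|lra]. }
unfold H at 2, I at 2 in hmono.
rewrite !RInt_point in hmono. unfold zero in hmono; simpl in hmono.
rewrite Ropp_0, exp_0 in hmono.
apply Rle_trans with (H t); [now apply hint|].
fold (I t).
replace (H t) with (H t * exp (- I t) * exp (I t)).
- apply Rmult_le_compat_r; [left; apply exp_pos|lra].
- rewrite Rmult_assoc, <- exp_plus, Rplus_opp_l, exp_0. ring.
Qed.

(** * Polar coordinates and continuity of the maximum modulus *)

Definition cis (theta : R) : C := (cos theta, sin theta).

Lemma Cmod_cis (theta : R) : Cmod (cis theta) = 1.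
Proof.
unfold Cmod, cis; simpl.
replace (cos theta * (cos theta * 1) + sin theta * (sin theta * 1)) with 1.
- apply sqrt_1.
- assert (h := sin2_cos2 theta). unfold Rsqr in h. lra.
Qed.

Lemma Cmod_polar (t theta : R) : Cmod (t * cis theta)%C = Rabs t.
Proof. rewrite Cmod_mult, Cmod_cis, Cmod_R. ring. Qed.

(** The angle is confined to a compact interval so that uniform continuity
    applies to functions of (radius, angle). *)
Lemma polar_exists (z : C) :
  exists theta, -PI <= theta <= PI /\ z = (Cmod z * cis theta)%C.
Proof.
assert (hPI := PI_RGT_0).
destruct (Rle_lt_or_eq_dec 0 (Cmod z) (Cmod_ge_0 z)) as [hz|hz].
2:{ exists 0. split; [lra|]. rewrite <- hz.
    rewrite (Cmod_eq_0 z (eq_sym hz)). ring. }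
destruct z as [x y]. set (r := Cmod (x, y)) in *.
assert (h2 : x ^ 2 + y ^ 2 = r ^ 2).
{ unfold r, Cmod, fst, snd. rewrite pow2_sqrt; [reflexivity|nra]. }
assert (hq : (x / r) ^ 2 + (y / r) ^ 2 = 1).
{ replace ((x / r) ^ 2 + (y / r) ^ 2) with ((x ^ 2 + y ^ 2) / r ^ 2)
    by (field; lra).
  rewrite h2. field. lra. }
assert (hb : -1 <= x / r <= 1) by (split; nra).
assert (hac := acos_bound (x / r)).
assert (hs : sin (acos (x / r)) = Rabs (y / r)).
{ rewrite sin_acos by exact hb. rewrite <- sqrt_Rsqr_abs. f_equal.
  unfold Rsqr. lra. }
assert (hx : x = r * (x / r)) by (field; lra).
assert (hy : y = r * (y / r)) by (field; lra).
destruct (Rle_dec 0 (y / r)) as [hp|hp].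
- exists (acos (x / r)). split; [lra|].
  unfold cis. rewrite hs, cos_acos, Rabs_pos_eq by assumption.
  unfold Cmult, RtoC; simpl. f_equal; lra.
- exists (- acos (x / r)). split; [lra|].
  unfold cis. rewrite cos_neg, sin_neg, hs, cos_acos, Rabs_left by lra.
  unfold Cmult, RtoC; simpl. f_equal; lra.
Qed.

(** Differentiability over C yields continuity for the uniform structure of the
    absolute value; what is composed with real maps below is the product
    structure, whose neighbourhoods are the same by [locally_C]. *)
Lemma continuous_of_ex_derive_C (F : C -> C) (z : C) :
  ex_derive F z -> continuous (T := C_UniformSpace) (U := C_UniformSpace) F z.
Proof.
intros hd. apply ex_derive_continuous in hd.
intros P hP. specialize (hd P hP).
unfold filtermap in hd |- *. now apply locally_C in hd.
Qed.

Lemma continuous_Cmod (z : C) :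
  continuous (T := C_UniformSpace) (U := R_UniformSpace) Cmod z.
Proof. exact (filterlim_norm (K := C_AbsRing) (V := C_NormedModule) z). Qed.

Lemma continuous_pair (U : UniformSpace) (f g : U -> R) (x : U) :
  continuous f x -> continuous g x ->
  continuous (U := C_UniformSpace) (fun y => (f y, g y)) x.
Proof.
intros hf hg. apply filterlim_locally. intros eps.
generalize (filter_and _ _ (proj1 (filterlim_locally _ _) hf eps)
                           (proj1 (filterlim_locally _ _) hg eps)).
apply filter_imp. intros y [h1 h2]. split; assumption.
Qed.

Lemma continuous_line (e : C) (t : R) :
  continuous (U := C_UniformSpace) (fun s : R => (s * e)%C) t.
Proof.
destruct e as [x y].
apply (continuous_ext (fun s => (s * x, s * y))).
- intros s. unfold Cmult, RtoC; simpl. f_equal; ring.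
- apply continuous_pair.
  + apply (continuous_mult (fun s : R => s) (fun _ => x));
      [apply continuous_id|apply continuous_const].
  + apply (continuous_mult (fun s : R => s) (fun _ => y));
      [apply continuous_id|apply continuous_const].
Qed.

Lemma continuous_ray (F : C -> C) (e : C) (t : R) :
  ex_derive F (t * e)%C ->
  continuous (fun s : R => Cmod (F (s * e)%C)) t.
Proof.
intros hd.
apply (continuous_comp (fun s : R => F (s * e)%C) Cmod); [|apply continuous_Cmod].
apply (continuous_comp (fun s : R => (s * e)%C) F);
  [|now apply continuous_of_ex_derive_C].
apply continuous_line.
Qed.

Lemma continuity_2d_polar (F : C -> C) (t theta : R) :
  ex_derive F (t * cis theta)%C ->
  continuity_2d_pt (fun s phi => Cmod (F (s * cis phi)%C)) t theta.
Proof.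
intros hd. apply continuity_2d_pt_filterlim.
change (continuous (T := prod_UniformSpace R_UniformSpace R_UniformSpace)
  (fun p : R * R => Cmod (F (fst p * cis (snd p))%C)) (t, theta)).
apply (continuous_comp (fun p : R * R => F (fst p * cis (snd p))%C) Cmod);
  [|apply continuous_Cmod].
apply (continuous_comp (fun p : R * R => (fst p * cis (snd p))%C) F);
  [|now apply continuous_of_ex_derive_C].
apply (continuous_ext
  (fun p : R * R => (fst p * cos (snd p), fst p * sin (snd p)))).
- intros p. unfold Cmult, RtoC, cis; simpl. f_equal; ring.
- apply continuous_pair.
  + apply (continuous_mult (fun p : R * R => fst p) (fun p => cos (snd p)));
      [apply continuous_fst|].
    apply (continuous_comp (fun p : R * R => snd p) cos);
      [apply continuous_snd|apply continuous_cos].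
  + apply (continuous_mult (fun p : R * R => fst p) (fun p => sin (snd p)));
      [apply continuous_fst|].
    apply (continuous_comp (fun p : R * R => snd p) sin);
      [apply continuous_snd|apply continuous_sin].
Qed.

Lemma M_infty_ge (F : C -> C) (z : C) :
  analytic_in_disc F -> Cmod z < 1 -> Cmod (F z) <= M_infty (Cmod z) F.
Proof.
intros hF hz.
apply (M_infty_correct (Cmod z) F hF (conj (Cmod_ge_0 z) hz)). reflexivity.
Qed.

Lemma M_infty_nonneg (F : C -> C) (r : R) :
  analytic_in_disc F -> 0 <= r < 1 -> 0 <= M_infty r F.
Proof.
intros hF hr. destruct (M_infty_correct r F hF hr) as [[z [_ <-]] _].
apply Cmod_ge_0.
Qed.

(** If the maximum on the circle of radius s is attained at angle phi, the
    point of angle phi on the circle of radius r has nearly the same |F|, so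
    M(s) < M(r) + eps; then exchange r and s. *)
Lemma M_infty_uniformly_continuous (F : C -> C) (R0 : R) :
  analytic_in_disc F -> R0 < 1 ->
  forall eps : posreal, exists delta : posreal, forall r s : R,
    0 <= r <= R0 -> 0 <= s <= R0 -> Rabs (s - r) < delta ->
    Rabs (M_infty s F - M_infty r F) < eps.
Proof.
intros hF hR eps.
destruct (uniform_continuity_2d (fun s phi => Cmod (F (s * cis phi)%C))
            0 R0 (-PI) PI) with (eps := eps) as [delta hdelta].
{ intros t phi ht _. apply continuity_2d_polar, hF.
  rewrite Cmod_polar, Rabs_pos_eq; lra. }
exists delta.
assert (half : forall r s, 0 <= r <= R0 -> 0 <= s <= R0 ->
          Rabs (s - r) < delta -> M_infty s F < M_infty r F + eps).
{ intros r s hr hs hrs.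
  destruct (M_infty_correct s F hF ltac:(lra)) as [[z [hz <-]] _].
  destruct (polar_exists z) as [phi [hphi hpol]]. rewrite hz in hpol.
  specialize (hdelta r phi s phi hr hphi hs hphi hrs).
  rewrite Rminus_diag, Rabs_R0 in hdelta. specialize (hdelta (cond_pos delta)).
  rewrite <- hpol in hdelta.
  assert (h := M_infty_ge F (r * cis phi)%C hF).
  rewrite Cmod_polar, Rabs_pos_eq in h by lra. specialize (h ltac:(lra)).
  apply Rabs_def2 in hdelta. lra. }
intros r s hr hs hrs.
assert (h1 := half r s hr hs hrs).
rewrite Rabs_minus_sym in hrs.
assert (h2 := half s r hs hr hrs).
apply Rabs_def1; lra.
Qed.

(** The absolute value extends the maximum modulus evenly to (-1,1), which makes
    it continuous at 0 from both sides; a lower integration bound 0 is then an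
    interior point. *)
Lemma continuous_M_infty (F : C -> C) (t : R) :
  analytic_in_disc F -> -1 < t < 1 ->
  continuous (fun s => M_infty (Rabs s) F) t.
Proof.
intros hF ht. apply filterlim_locally. intros eps.
assert (hat : Rabs t < 1) by (apply Rabs_def1; lra).
assert (ha0 := Rabs_pos t).
set (R0 := (1 + Rabs t) / 2).
destruct (M_infty_uniformly_continuous F R0 hF ltac:(unfold R0; lra) eps)
  as [delta hdelta].
assert (hm : 0 < Rmin delta ((1 - Rabs t) / 2)).
{ apply Rmin_glb_lt; [apply cond_pos|lra]. }
exists (mkposreal _ hm). intros s hs.
change (Rabs (s - t) < Rmin delta ((1 - Rabs t) / 2)) in hs.
change (Rabs (M_infty (Rabs s) F - M_infty (Rabs t) F) < eps).
assert (h1 := Rmin_l delta ((1 - Rabs t) / 2)).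
assert (h2 := Rmin_r delta ((1 - Rabs t) / 2)).
assert (h3 := Rabs_triang_inv2 s t).
assert (h4 := Rabs_triang_inv s t). assert (h5 := Rabs_pos s).
apply hdelta; unfold R0; lra.
Qed.

Lemma analytic_bounded_on_closed_disc (F : C -> C) (R0 : R) :
  analytic_in_disc F -> 0 <= R0 < 1 ->
  exists B, forall z, Cmod z <= R0 -> Cmod (F z) <= B.
Proof.
intros hF hR.
destruct (continuity_ab_maj (fun s => M_infty (Rabs s) F) 0 R0) as [x [hx _]].
- lra.
- intros s hs. apply continuity_pt_filterlim, continuous_M_infty; [assumption|lra].
- exists (M_infty (Rabs x) F). intros z hz. assert (h0 := Cmod_ge_0 z).
  apply Rle_trans with (M_infty (Cmod z) F); [apply M_infty_ge; [assumption|lra]|].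
  specialize (hx (Cmod z) ltac:(lra)). now rewrite (Rabs_pos_eq _ h0) in hx.
Qed.

(** * Increments of analytic functions along a ray *)

(** The constant c is kept inside because every use tests the increment of F
    against a unimodular c. *)
Lemma is_derive_ray (F : C -> C) (c e l : C) (t : R) :
  is_derive F (t * e)%C l ->
  is_derive (fun s : R => Re (c * F (s * e))%C) t (Re (c * (e * l))%C).
Proof.
intros [_ hd]. specialize (hd _ (fun P hP => hP)).
split; [apply is_linear_scal_l|].
intros x hx.
assert (htx : t = x)
  by exact (is_filter_lim_locally_unique (V := AbsRing_NormedModule R_AbsRing) t x hx).
subst x.
intros eps.
(* The summand 1 keeps k positive when c or e vanishes. *)
set (k := Cmod c * Cmod e + 1).
assert (hc := Cmod_ge_0 c). assert (he := Cmod_ge_0 e).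
assert (hk : 0 < k) by (unfold k; nra).
assert (hek : 0 < eps / k) by (apply Rdiv_lt_0_compat; [apply cond_pos|exact hk]).
specialize (hd (mkposreal _ hek)). apply locally_C in hd.
assert (hcont : continuous (U := C_UniformSpace) (fun s : R => (s * e)%C) t).
{ apply continuous_line. }
specialize (hcont _ hd). revert hcont. unfold filtermap.
apply filter_imp. intros s hs.
change (Cmod (F (s * e) - F (t * e) - (s * e - t * e) * l)%C
        <= eps / k * Cmod (s * e - t * e)%C) in hs.
change (Rabs (Re (c * F (s * e))%C - Re (c * F (t * e))%C
              - (s - t) * Re (c * (e * l))%C) <= eps * Rabs (s - t)).
replace (Re (c * F (s * e))%C - Re (c * F (t * e))%C - (s - t) * Re (c * (e * l))%C)
  with (Re (c * (F (s * e) - F (t * e) - (s * e - t * e) * l))%C).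
2:{ rewrite <- re_scal_l. unfold Rminus.
    rewrite <- !re_opp, <- !re_plus. f_equal. rewrite RtoC_plus, RtoC_opp. ring. }
apply Rle_trans with (1 := re_le_Cmod _). rewrite Cmod_mult.
replace (s * e - t * e)%C with ((s - t)%R * e)%C in hs
  by (rewrite RtoC_minus; ring).
rewrite Cmod_mult, Cmod_R in hs.
apply Rle_trans with (Cmod c * (eps / k * (Rabs (s - t) * Cmod e))).
{ apply Rmult_le_compat_l; [exact hc|].
  replace (s * e - t * e)%C with ((s - t)%R * e)%C
    by (rewrite RtoC_minus; ring). exact hs. }
replace (Cmod c * (eps / k * (Rabs (s - t) * Cmod e)))
  with (eps / k * (Cmod c * Cmod e) * Rabs (s - t)) by ring.
apply Rmult_le_compat_r; [apply Rabs_pos|].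
replace (pos eps) with (eps / k * k) at 2 by (field; lra).
apply Rmult_le_compat_l; [lra|unfold k; lra].
Qed.

Lemma norming_scalar (w : C) :
  exists c : C, Cmod c = 1 /\ Re (c * w)%C = Cmod w.
Proof.
destruct (polar_exists w) as [phi [_ hw]].
exists (cis (- phi)). split; [apply Cmod_cis|].
rewrite hw at 1. generalize (Cmod w). intros r.
rewrite re_mult, re_scal_l, im_scal_l.
unfold cis, Re, Im; simpl. rewrite cos_neg, sin_neg.
transitivity (r * (Rsqr (sin phi) + Rsqr (cos phi))).
- unfold Rsqr. ring.
- rewrite sin2_cos2. ring.
Qed.

(** Mean value inequality along a ray; g is any primitive of a majorant of
    |F'|. *)
Lemma ray_increment_le (F : C -> C) (e : C) (g dg : R -> R) (x r : R) :
  Cmod e = 1 -> x <= r ->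
  (forall t, x <= t <= r -> ex_derive F (t * e)%C) ->
  (forall t, x <= t <= r -> is_derive g t (dg t)) ->
  (forall t, x < t < r -> Cmod (C_derive F (t * e)%C) <= dg t) ->
  Cmod (F (r * e)%C) <= Cmod (F (x * e)%C) + (g r - g x).
Proof.
intros he hxr hF hg hle.
destruct (norming_scalar (F (r * e)%C)) as [c [hc hre]].
assert (h : Re (c * F (r * e))%C - Re (c * F (x * e))%C <= g r - g x).
{ apply (increment_le (fun s : R => Re (c * F (s * e))%C) g
           (fun s : R => Re (c * (e * C_derive F (s * e)))%C) dg); try assumption.
  - intros t ht. apply is_derive_ray. apply C_derive_correct; [exact 0%C|].
    now apply hF.
  - intros t ht. apply Rle_trans with (2 := hle t ht).
    apply Rle_trans with (1 := Rle_abs _). apply Rle_trans with (1 := re_le_Cmod _).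
    rewrite !Cmod_mult, hc, he. lra. }
assert (h2 := re_le_Cmod (c * F (x * e))%C).
rewrite Cmod_mult, hc in h2. assert (h3 := Rle_abs (Re (c * F (x * e))%C)). lra.
Qed.

(** The auxiliary function F(se) + (r-s) e F'(se) takes the value F(re) at
    s = r and has derivative (r-s) e^2 F''(se), the terms in F' cancelling:
    this is Taylor's formula with integral remainder, without the integral. *)
Lemma ray_taylor_le (F : C -> C) (e : C) (g dg : R -> R) (x r : R) :
  Cmod e = 1 -> x <= r ->
  (forall t, x <= t <= r -> ex_derive F (t * e)%C) ->
  (forall t, x <= t <= r -> ex_derive (C_derive F) (t * e)%C) ->
  (forall t, x <= t <= r -> is_derive g t (dg t)) ->
  (forall t, x < t < r ->
     (r - t) * Cmod (C_derive (C_derive F) (t * e)%C) <= dg t) ->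
  Cmod (F (r * e)%C) <=
    Cmod (F (x * e)%C) + (r - x) * Cmod (C_derive F (x * e)%C) + (g r - g x).
Proof.
intros he hxr hF hF' hg hle.
destruct (norming_scalar (F (r * e)%C)) as [c [hc hre]].
set (d1 := fun s : R => Re (c * (e * C_derive F (s * e)))%C).
set (d2 := fun s : R => Re (c * e * (e * C_derive (C_derive F) (s * e)))%C).
set (p := fun s : R => Re (c * F (s * e))%C + (r - s) * d1 s).
assert (h : p r - p x <= g r - g x).
{ apply (increment_le p g
           (fun s => d1 s + (-1 * d1 s + (r - s) * d2 s)) dg); try assumption.
  - intros t ht. unfold p.
    apply (is_derive_plus (K := R_AbsRing) (V := R_NormedModule)
             (fun s : R => Re (c * F (s * e))%C) (fun s => (r - s) * d1 s)).
    + apply is_derive_ray, C_derive_correct; [exact 0%C|]. now apply hF.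
    + apply (is_derive_mult (fun s => r - s) d1).
      * auto_derive; [exact I|ring].
      * apply (is_derive_ext (fun s : R => Re (c * e * C_derive F (s * e))%C)).
        { intros s. unfold d1. f_equal. ring. }
        apply is_derive_ray, C_derive_correct; [exact 0%C|]. now apply hF'.
      * intros n m. apply Rmult_comm.
  - intros t ht. apply Rle_trans with (2 := hle t ht).
    replace (d1 t + (-1 * d1 t + (r - t) * d2 t)) with ((r - t) * d2 t) by ring.
    apply Rmult_le_compat_l; [lra|]. unfold d2.
    apply Rle_trans with (1 := Rle_abs _). apply Rle_trans with (1 := re_le_Cmod _).
    rewrite !Cmod_mult, hc, he. lra. }
unfold p in h. rewrite hre in h.
assert (h2 := re_le_Cmod (c * F (x * e))%C).
rewrite Cmod_mult, hc in h2. assert (h3 := Rle_abs (Re (c * F (x * e))%C)).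
assert (h4 := re_le_Cmod (c * (e * C_derive F (x * e)))%C).
rewrite !Cmod_mult, hc, he in h4. fold (d1 x) in h4.
assert (h5 := Rle_abs (d1 x)).
assert (h6 : (r - x) * d1 x <= (r - x) * Cmod (C_derive F (x * e)%C))
  by (apply Rmult_le_compat_l; lra).
lra.
Qed.

(** * The differential equation *)

Lemma solution_second_derivative (A f : C -> C) (z : C) :
  is_solution_in_disc A f -> Cmod z < 1 ->
  C_derive (C_derive f) z = (- (A z * f z))%C.
Proof.
intros hsol hz. destruct (hsol z hz) as [_ heq].
replace (C_derive (C_derive f) z)
  with (C_derive (C_derive f) z + A z * f z - A z * f z)%C by ring.
rewrite heq. ring.
Qed.

(** Second-order Taylor along the ray and Gronwall.  The constant is uniform in
    the direction because the initial data f, f' are bounded on the circle of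
    radius r0 by their maximum moduli. *)
Lemma solution_growth (A f : C -> C) (r0 : R) :
  analytic_in_disc A -> analytic_in_disc f -> is_solution_in_disc A f ->
  0 <= r0 < 1 ->
  exists C0, 0 <= C0 /\ forall (theta r : R), r0 <= r < 1 ->
    Cmod (f (r * cis theta)%C) <=
      C0 * exp (RInt (fun t => M_infty t A * (1 - t)) r0 r).
Proof.
intros hA hf hsol hr0.
assert (hf' : analytic_in_disc (C_derive f)) by (intros z hz; now apply hsol).
assert (hMf := M_infty_nonneg f r0 hf hr0).
assert (hMf' := M_infty_nonneg (C_derive f) r0 hf' hr0).
exists (M_infty r0 f + (1 - r0) * M_infty r0 (C_derive f)).
split; [nra|].
intros theta.
assert (hdisc : forall t : R, -1 < t < 1 -> Cmod (t * cis theta)%C < 1).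
{ intros t ht. rewrite Cmod_polar. apply Rabs_def1; lra. }
assert (hmod : forall t : R, 0 <= t -> Cmod (t * cis theta)%C = t).
{ intros t ht. now rewrite Cmod_polar, Rabs_pos_eq. }
set (a := fun t => M_infty (Rabs t) A * (1 - t)).
set (u := fun t : R => Cmod (f (t * cis theta)%C)).
assert (ha : forall t, -1 < t < 1 -> continuous a t).
{ intros t ht. apply (continuous_mult (fun s => M_infty (Rabs s) A) (fun s => 1 - s)).
  - now apply continuous_M_infty.
  - apply continuity_pt_filterlim. reg. }
assert (hu : forall t, -1 < t < 1 -> continuous u t).
{ intros t ht. apply continuous_ray, hf, hdisc, ht. }
intros r hr.
rewrite (RInt_ext _ a).
2:{ intros t ht. revert ht. rewrite Rmin_left, Rmax_right by lra. intros ht.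
    unfold a. rewrite Rabs_pos_eq by lra. reflexivity. }
apply (gronwall a u (-1) 1 r0); try assumption; try lra.
- intros t ht. unfold a. rewrite Rabs_pos_eq by lra.
  apply Rmult_le_pos; [apply M_infty_nonneg; [assumption|lra]|lra].
- clear r hr. intros r hr.
  assert (hau : forall t, -1 < t < 1 -> continuous (fun s => a s * u s) t).
  { intros t ht. apply (continuous_mult a u); [now apply ha|now apply hu]. }
  assert (h := ray_taylor_le f (cis theta) (fun y => RInt (fun s => a s * u s) r0 y)
     (fun s => a s * u s) r0 r (Cmod_cis theta) (proj1 hr)).
  simpl in h. rewrite RInt_point in h. unfold zero in h; simpl in h.
  assert (h1 := M_infty_ge f (r0 * cis theta)%C hf (hdisc r0 ltac:(lra))).
  assert (h2 := M_infty_ge _ (r0 * cis theta)%C hf' (hdisc r0 ltac:(lra))).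
  rewrite hmod in h1, h2 by lra.
  assert (h3 : (r - r0) * Cmod (C_derive f (r0 * cis theta)%C)
               <= (1 - r0) * M_infty r0 (C_derive f)).
  { apply Rmult_le_compat; [lra|apply Cmod_ge_0|lra|exact h2]. }
  assert (h4 : Cmod (f (r * cis theta)%C) <=
    Cmod (f (r0 * cis theta)%C) + (r - r0) * Cmod (C_derive f (r0 * cis theta)%C)
    + (RInt (fun s => a s * u s) r0 r - 0)).
  { apply h.
    - intros t ht. apply hf, hdisc. lra.
    - intros t ht. apply hf', hdisc. lra.
    - intros t ht.
      apply (is_derive_RInt_continuous (fun s => a s * u s) (-1) 1); [assumption|lra|lra].
    - intros t ht.
      rewrite (solution_second_derivative A f _ hsol (hdisc t ltac:(lra))).
      rewrite Cmod_opp, Cmod_mult. fold (u t). unfold a.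
      assert (h5 := M_infty_ge A (t * cis theta)%C hA (hdisc t ltac:(lra))).
      rewrite hmod in h5 by lra. rewrite Rabs_pos_eq by lra.
      assert (h6 : 0 <= u t) by apply Cmod_ge_0.
      rewrite <- Rmult_assoc. apply Rmult_le_compat_r; [exact h6|].
      rewrite Rmult_comm. apply Rmult_le_compat; [apply Cmod_ge_0|lra|exact h5|lra]. }
  fold (u r) in h4. lra.
Qed.

Theorem theorem1 (A : C -> C) (hA : analytic_in_disc A)
  (hsup : exists r0 : R, 0 <= r0 < 1 /\
    exists K : R, forall r : R, r0 < r < 1 ->
      M_infty r A * (1 - r) ^ 2 *
        exp (RInt (fun t : R => M_infty t A * (1 - t)) r0 r) <= K)
  (f : C -> C) (hf : analytic_in_disc f) (hsol : is_solution_in_disc A f) :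
  in_Bloch f.
Proof.
split; [exact hf|].
destruct hsup as [r0 [hr0 [K hK]]].
assert (hf' : analytic_in_disc (C_derive f)) by (intros z hz; now apply hsol).
destruct (solution_growth A f r0 hA hf hsol hr0) as [C0 [hC0 hgrow]].
destruct (analytic_bounded_on_closed_disc _ r0 hf' hr0) as [B hB].
assert (hB0 : 0 <= B).
{ apply Rle_trans with (1 := Cmod_ge_0 (C_derive f 0%C)). apply hB.
  rewrite Cmod_0. lra. }
(* Any radius in (r0,1) shows this; the midpoint is one. *)
assert (hK0 : 0 <= K).
{ set (m := (r0 + 1) / 2).
  apply Rle_trans with (2 := hK m ltac:(unfold m; lra)).
  apply Rmult_le_pos; [apply Rmult_le_pos|left; apply exp_pos].
  - apply M_infty_nonneg; [assumption|unfold m; lra].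
  - apply pow2_ge_0. }
assert (hCK : 0 <= C0 * K) by now apply Rmult_le_pos.
exists (2 * (B + C0 * K)). intros z hz.
assert (hz0 := Cmod_ge_0 z).
(* 1 - |z|^2 <= 2 (1 - |z|) accounts for the factor 2. *)
enough (hmain : Cmod (C_derive f z) * (1 - Cmod z) <= B + C0 * K).
{ assert (h := Cmod_ge_0 (C_derive f z)).
  replace (Cmod (C_derive f z) * (1 - Cmod z ^ 2))
    with (Cmod (C_derive f z) * (1 - Cmod z) * (1 + Cmod z)) by ring.
  rewrite (Rmult_comm 2).
  apply Rmult_le_compat; [apply Rmult_le_pos; lra|lra|exact hmain|lra]. }
destruct (Rle_dec (Cmod z) r0) as [hle|hgt].
{ specialize (hB z hle). assert (h := Cmod_ge_0 (C_derive f z)). nra. }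
destruct (polar_exists z) as [theta [_ hpol]].
set (r := Cmod z) in *.
assert (hr : r0 < r) by lra. clear hgt.
assert (hdisc : forall t : R, -1 < t < 1 -> Cmod (t * cis theta)%C < 1).
{ intros t ht. rewrite Cmod_polar. apply Rabs_def1; lra. }
assert (h := ray_increment_le (C_derive f) (cis theta)
  (fun t => C0 * K / (1 - t)) (fun t => C0 * K / (1 - t) ^ 2) r0 r
  (Cmod_cis theta) ltac:(lra)).
simpl in h. rewrite <- hpol in h.
assert (h1 : Cmod (C_derive f z) <= Cmod (C_derive f (r0 * cis theta)%C)
   + (C0 * K / (1 - r) - C0 * K / (1 - r0))).
{ apply h; clear h.
  - intros t ht. apply hf', hdisc. lra.
  - intros t ht. auto_derive; [lra|field; lra].
  - intros t ht.
    rewrite (solution_second_derivative A f _ hsol (hdisc t ltac:(lra))).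
    rewrite Cmod_opp, Cmod_mult.
    assert (h2 := M_infty_ge A (t * cis theta)%C hA (hdisc t ltac:(lra))).
    rewrite Cmod_polar, Rabs_pos_eq in h2 by lra.
    specialize (hgrow theta t ltac:(lra)). specialize (hK t ltac:(lra)).
    set (E := exp (RInt (fun t => M_infty t A * (1 - t)) r0 t)) in *.
    apply Rmult_le_reg_r with ((1 - t) ^ 2); [apply pow_lt; lra|].
    replace (C0 * K / ((1 - t) * ((1 - t) * 1)) * (1 - t) ^ 2) with (C0 * K)
      by (field; lra).
    apply Rle_trans with (M_infty t A * (C0 * E) * (1 - t) ^ 2).
    + apply Rmult_le_compat_r; [apply pow2_ge_0|].
      apply Rmult_le_compat; [apply Cmod_ge_0|apply Cmod_ge_0|exact h2|exact hgrow].
    + replace (M_infty t A * (C0 * E) * (1 - t) ^ 2)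
        with (C0 * (M_infty t A * (1 - t) ^ 2 * E)) by ring.
      now apply Rmult_le_compat_l. }
assert (h2 : Cmod (C_derive f (r0 * cis theta)%C) <= B).
{ apply hB. rewrite Cmod_polar, Rabs_pos_eq; lra. }
assert (h3 : 0 <= C0 * K / (1 - r0)).
{ apply Rmult_le_pos; [exact hCK|]. left. apply Rinv_0_lt_compat. lra. }
apply Rle_trans with ((B + C0 * K / (1 - r)) * (1 - r)).
- apply Rmult_le_compat_r; lra.
- replace ((B + C0 * K / (1 - r)) * (1 - r)) with (B * (1 - r) + C0 * K)
    by (field; lra).
  nra.
Qed.
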